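(* Let $k\ge1$ and $p\ge0$ be integers. For an arbitrary $N$-dimensional Frobenius manifold that is given locally by a solution $\Phi(u^1,\dots,u^N)$ of the associativity equations, the corresponding $k$-potential submanifolds in $((k+1)N+p)$-dimensional pseudo-Euclidean spaces that realize this Frobenius manifold are determined by any $((k+1)N+p)$-component vector function $r(u^1,\dots,u^N)$ satisfying the following consistent linear system of second-order partial differential equations: $$\frac{\partial^2 r}{\partial u^i\partial u^j}=\sum_{\sigma,\tau=1}^k\sum_{m,l=1}^N c^{\sigma\tau}\eta^{ml}\frac{\partial^3\Phi}{\partial u^i\partial u^j\partial u^m}\,n_{(\tau-1)N+l}(u)+\sum_{\beta=kN+1}^{kN+p}\sum_{\sigma=1}^k\sum_{m=1}^N\mu^{(\sigma-1)N+m,\beta}\frac{\partial^3\Phi}{\partial u^i\partial u^j\partial u^m}\,n_\beta(u),\quad 1\le i,j\le N,$$ $$\frac{\partial n_{(\sigma-1)N+m}}{\partial u^i}=-\sum_{l,j=1}^N\eta^{jl}\frac{\partial^3\Phi}{\partial u^l\partial u^m\partial u^i}\frac{\partial r}{\partial u^j},\quad 1\le\sigma\le k,\ 1\le i,m\le N,$$ $$\frac{\partial n_\alpha}{\partial u^i}=0,\quad kN+1\le\alpha\le kN+p,\ 1\le i\le N,$$ where $n_\alpha(u^1,\dots,u^N)$, $1\le\alpha\le kN+p$, are some $((k+1)N+p)$-component vector functions. The consistency conditions for this linear system are equivalent to the associativity equations for the function $\Phi(u)$.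
   Context: **Data.** Put $L=kN+p$. The matrices $(\eta^{ij})$ ($N\times N$), $(c^{\sigma\tau})$ ($k\times k$) and $(\mu^{\alpha\beta})$ ($L\times L$) are constant, symmetric and nondegenerate, with $\mu^{(\sigma-1)N+m,(\tau-1)N+n}=c^{\sigma\tau}\eta^{mn}$ for $1\le\sigma,\tau\le k$, $1\le m,n\le N$. The other entries of $\mu^{\alpha\beta}$ are arbitrary constants such that $\mu$ is symmetric and nondegenerate. $(\eta_{ij})$ and $(\mu_{\alpha\beta})$ denote the inverse matrices. **Associativity (WDVV) equations** for $\Phi$: for all $i,j,m,n$, $$\sum_{a,b=1}^N\frac{\partial^3\Phi}{\partial u^i\partial u^j\partial u^a}\eta^{ab}\frac{\partial^3\Phi}{\partial u^b\partial u^m\partial u^n}=\sum_{a,b=1}^N\frac{\partial^3\Phi}{\partial u^i\partial u^m\partial u^a}\eta^{ab}\frac{\partial^3\Phi}{\partial u^b\partial u^j\partial u^n}.$$ **Frobenius manifold:** a manifold with a flat pseudo-Riemannian metric $g$ and a smoothly varying commutative associative multiplication $\circ$ on its tangent spaces such that $g(X\circ Y,Z)=g(X,Y\circ Z)$ and, for the symmetric tensor $A(X,Y,Z)=g(X\circ Y,Z)$, the tensor $(\nabla_WA)(X,Y,Z)$ is symmetric in $X,Y,Z,W$ ($\nabla$ is the Levi-Civita connection of $g$). No unit or Euler field is required. Locally, in flat coordinates $u$, $g=\eta_{ij}du^idu^j$ and $\partial_i\circ\partial_j=\sum_{l,s}\eta^{ls}\frac{\partial^3\Phi}{\partial u^s\partial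 u^i\partial u^j}\partial_l$, where $\Phi$ solves the associativity equations. **$k$-potential submanifold** (for a solution $\Phi$ and data $\eta,c,\mu$): an $N$-dimensional submanifold, with nondegenerate first fundamental form, of a pseudo-Euclidean space of dimension $N+L=(k+1)N+p$ whose signature is the sum of the signatures of $\eta_{ij}$ and $\mu_{\alpha\beta}$. It is given locally by a position vector $r(u)$ with a basis $n_1(u),\dots,n_L(u)$ of the normal spaces such that: the first fundamental form is $(\partial_ir,\partial_jr)=\eta_{ij}$; the Gram matrix is $(n_\alpha,n_\beta)=\mu_{\alpha\beta}$; the torsion coefficients $(\partial_in_\alpha,n_\beta)$ vanish; and the second fundamental forms $\omega_{\alpha ij}=(\partial_i\partial_jr,n_\alpha)$ are $\omega_{(\sigma-1)N+m,ij}=\partial^3\Phi/\partial u^m\partial u^i\partial u^j$ for $1\le\sigma\le k$, $1\le m\le N$, and $\omega_{\alpha ij}=0$ for $kN+1\le\alpha\le L$. It realizes the Frobenius manifold given by $\Phi$: the multiplication has structure functions $c^l_{mj}=\sum_i\eta^{li}\omega_{(\sigma-1)N+m,ij}$ for each $\sigma$. **Convention.** The linear system in the claim consists of the Gauss decomposition (of $\partial_i\partial_jr$) and the Weingarten decomposition (of $\partial_in_\alpha$) for such a submanifold; $r$ is understood as the position vector of the submanifold, with first fundamental form $\eta_{ij}$, and the $n_\alpha$ as the basis of its normal spaces with Gram matrix $\mu_{\alpha\beta}$. **Consistency conditions:** the conditions on the coefficients obtained by equating mixed derivatives of $\partial_ir$ and of $n_\alpha$, re-expressing them by the system, and comparing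 coefficients of the $\partial_lr$ and $n_\alpha$. *)

(* Defs.v *)
From HB Require Import structures.
From mathcomp Require Import all_boot all_order all_algebra.
From mathcomp Require Import all_classical all_reals all_analysis.

Set Implicit Arguments.
Unset Strict Implicit.
Unset Printing Implicit Defensive.

Import Order.TTheory GRing.Theory Num.Theory.
Import numFieldNormedType.Exports.

Local Open Scope classical_set_scope.
Local Open Scope ring_scope.

Section Calculus.
Context {R : realType} {N : nat} {W : normedModType R}.

Definition partial (i : 'I_N) (f : 'rV[R]_N -> W) : 'rV[R]_N -> W :=
  'D_(delta_mx 0 i : 'rV[R]_N) f.

(* C^m on U: all iterated partial derivatives up to order m exist on U, those
   of order m being continuous there; values outside U play no role when U is
   open. *)
Fixpoint Ck (U : set 'rV[R]_N) (m : nat) (f : 'rV[R]_N -> W) : Prop :=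
  match m with
  | 0%N => forall u, U u -> {for u, continuous f}
  | m'.+1 =>
      (forall i u, U u -> derivable f u (delta_mx 0 i : 'rV[R]_N)) /\
      (forall i, Ck U m' (partial i f))
  end.

Definition smooth (U : set 'rV[R]_N) (f : 'rV[R]_N -> W) : Prop :=
  forall m, Ck U m f.

End Calculus.

Definition partial3 (R : realType) (N : nat) (Phi : 'rV[R]_N -> R)
    (i j m : 'I_N) : 'rV[R]_N -> R :=
  partial (W := R^o) i (partial (W := R^o) j (partial (W := R^o) m Phi)).

Definition bform (R : realType) (d : nat) (G : 'M[R]_d) (v w : 'rV[R]_d) : R :=
  (v *m G *m w^T) 0 0.

(* The nondegenerate symmetric form G is congruent to
   diag(1, ..., 1, -1, ..., -1), with s entries 1 and t entries -1. *)
Definition has_signature (R : realType) (d : nat) (G : 'M[R]_d) (s t : nat) :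
    Prop :=
  (s + t = d)%N /\
  exists2 P : 'M[R]_d, P \in unitmx &
    P *m G *m P^T = diag_mx (\row_(i < d) (-1) ^+ (s <= i)%N).

Lemma blk_subproof (k N : nat) (s : 'I_k) (m : 'I_N) : (s * N + m < k * N)%N.
Proof.
apply: (@leq_trans (s.+1 * N)); last by rewrite leq_mul2r ltn_ord orbT.
by rewrite mulSn addnC ltn_add2r ltn_ord.
Qed.

(* With indices starting at 0, the index (sigma-1)N+m of the normal frame
   becomes sigma * N + m; blk and extra together enumerate 'I_(k * N + p). *)
Definition blk (k N p : nat) (s : 'I_k) (m : 'I_N) : 'I_(k * N + p) :=
  lshift p (Ordinal (blk_subproof s m)).

Definition extra (k N p : nat) (b : 'I_p) : 'I_(k * N + p) := rshift (k * N) b.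

Arguments blk {k N p} s m.
Arguments extra {k N p} b.

Definition associativity (R : realType) (N : nat) (U : set 'rV[R]_N)
    (eta : 'M[R]_N) (Phi : 'rV[R]_N -> R) : Prop :=
  forall u, U u -> forall i j m n : 'I_N,
    \sum_(a < N) \sum_(b < N)
       partial3 Phi i j a u * eta a b * partial3 Phi b m n u =
    \sum_(a < N) \sum_(b < N)
       partial3 Phi i m a u * eta a b * partial3 Phi b j n u.

(* A Frobenius manifold in a chart U of flat coordinates: the metric is the
   constant matrix g, its Levi-Civita connection is the directional derivative,
   and mul u is the multiplication on the tangent space at u. *)
Record frobenius_chart (R : realType) (N : nat) (U : set 'rV[R]_N)
    (g : 'M[R]_N) (mul : 'rV[R]_N -> 'rV[R]_N -> 'rV[R]_N -> 'rV[R]_N) :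
    Prop := FrobeniusChart {
  frob_metric_sym : g^T = g;
  frob_metric_nondeg : g \in unitmx;
  frob_smooth : forall X Y, smooth U (fun u => mul u X Y);
  frob_linear : forall u, U u -> forall a X Y Z,
    mul u (a *: X + Y) Z = a *: mul u X Z + mul u Y Z;
  frob_comm : forall u, U u -> forall X Y, mul u X Y = mul u Y X;
  frob_assoc : forall u, U u -> forall X Y Z,
    mul u (mul u X Y) Z = mul u X (mul u Y Z);
  frob_invariant : forall u, U u -> forall X Y Z,
    bform g (mul u X Y) Z = bform g X (mul u Y Z);
  (* the three adjacent transpositions of (W, X, Y, Z) *)
  frob_nabla_sym : forall u, U u -> forall W X Y Z,
    let nablaA W X Y Z :=
      'D_W ((fun v => bform g (mul v X Y) Z) : 'rV[R]_N -> R^o) u in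
    [/\ nablaA W X Y Z = nablaA X W Y Z,
        nablaA W X Y Z = nablaA W Y X Z &
        nablaA W X Y Z = nablaA W X Z Y]
}.

Definition frobenius_potential (R : realType) (N : nat) (U : set 'rV[R]_N)
    (eta : 'M[R]_N) (Phi : 'rV[R]_N -> R)
    (mul : 'rV[R]_N -> 'rV[R]_N -> 'rV[R]_N -> 'rV[R]_N) : Prop :=
  forall u, U u -> forall i j : 'I_N,
    mul u (delta_mx 0 i) (delta_mx 0 j) =
    \sum_(l < N) (\sum_(s < N) eta l s * partial3 Phi s i j u) *: delta_mx 0 l.

Section Submanifolds.
Context {R : realType} {N L d : nat}.
Variables (U : set 'rV[R]_N) (G : 'M[R]_d).
Variables (r : 'rV[R]_N -> 'rV[R]_d) (nu : 'I_L -> 'rV[R]_N -> 'rV[R]_d).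

Definition first_form (u : 'rV[R]_N) (i j : 'I_N) : R :=
  bform G (partial i r u) (partial j r u).

Definition second_form (u : 'rV[R]_N) (a : 'I_L) (i j : 'I_N) : R :=
  bform G (partial i (partial j r) u) (nu a u).

Definition torsion (u : 'rV[R]_N) (i : 'I_N) (a b : 'I_L) : R :=
  bform G (partial i (nu a) u) (nu b u).

Definition normal_basis (u : 'rV[R]_N) : Prop :=
  let F := \matrix_(a < L) nu a u in
  row_free F /\
  forall v : 'rV[R]_d,
    (v <= F)%MS <-> forall i : 'I_N, bform G v (partial i r u) = 0.

(* eta and mu carry upper indices, so that the metric and the Gram matrix of
   the normal frame are their inverses; nondegeneracy of the first fundamental
   form, hence immersivity of r, comes from that of eta. *)
Record framed_submanifold (eta : 'M[R]_N) (mu : 'M[R]_L) : Prop :=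
  FramedSubmanifold {
  framed_pos_smooth : smooth U r;
  framed_normal_smooth : forall a, smooth U (nu a);
  framed_first_form : forall u, U u -> forall i j,
    first_form u i j = invmx eta i j;
  framed_normal_basis : forall u, U u -> normal_basis u;
  framed_gram : forall u, U u -> forall a b,
    bform G (nu a u) (nu b u) = invmx mu a b
}.

End Submanifolds.

Section PotentialSubmanifolds.
Context {R : realType} {k N p d : nat}.
Variables (U : set 'rV[R]_N) (Phi : 'rV[R]_N -> R).
Variables (eta : 'M[R]_N) (c : 'M[R]_k) (mu : 'M[R]_(k * N + p)).

Record k_potential_submanifold (G : 'M[R]_d) (r : 'rV[R]_N -> 'rV[R]_d)
    (nu : 'I_(k * N + p) -> 'rV[R]_N -> 'rV[R]_d) : Prop :=
  KPotentialSubmanifold {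
  kpot_framed : framed_submanifold U G r nu eta mu;
  kpot_torsion : forall u, U u -> forall i a b, torsion G nu u i a b = 0;
  kpot_second_form_blk : forall u, U u ->
    forall (s : 'I_k) (m i j : 'I_N),
      second_form G r nu u (blk s m) i j = partial3 Phi m i j u;
  kpot_second_form_free : forall u, U u ->
    forall (b : 'I_p) (i j : 'I_N), second_form G r nu u (extra b) i j = 0
}.

Definition realizes_frobenius
    (mul : 'rV[R]_N -> 'rV[R]_N -> 'rV[R]_N -> 'rV[R]_N)
    (G : 'M[R]_d) (r : 'rV[R]_N -> 'rV[R]_d)
    (nu : 'I_(k * N + p) -> 'rV[R]_N -> 'rV[R]_d) : Prop :=
  forall u, U u -> forall (s : 'I_k) (m j : 'I_N),
    mul u (delta_mx 0 m) (delta_mx 0 j) =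
    \sum_(l < N)
      (\sum_(i < N) eta l i * second_form G r nu u (blk s m) i j)
      *: delta_mx 0 l.

Definition gauss_blk (t : 'I_k) (l i j : 'I_N) (u : 'rV[R]_N) : R :=
  \sum_(s < k) \sum_(m < N) c s t * eta m l * partial3 Phi i j m u.

Definition gauss_free (b : 'I_p) (i j : 'I_N) (u : 'rV[R]_N) : R :=
  \sum_(s < k) \sum_(m < N) mu (blk s m) (extra b) * partial3 Phi i j m u.

Definition weingarten (m i j : 'I_N) (u : 'rV[R]_N) : R :=
  - \sum_(l < N) eta j l * partial3 Phi l m i u.

Record linear_system (r : 'rV[R]_N -> 'rV[R]_d)
    (nu : 'I_(k * N + p) -> 'rV[R]_N -> 'rV[R]_d) : Prop := LinearSystem {
  sys_gauss : forall u, U u -> forall i j : 'I_N,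
    partial i (partial j r) u =
      \sum_(t < k) \sum_(l < N) gauss_blk t l i j u *: nu (blk t l) u +
      \sum_(b < p) gauss_free b i j u *: nu (extra b) u;
  sys_weingarten_blk : forall u, U u -> forall (s : 'I_k) (m i : 'I_N),
    partial i (nu (blk s m)) u =
      \sum_(j < N) weingarten m i j u *: partial j r u;
  sys_weingarten_free : forall u, U u -> forall (b : 'I_p) (i : 'I_N),
    partial i (nu (extra b)) u = 0
}.

(* A formal combination
     sum_j tcoef_j d_j r + sum_(s,m) nblk_(s,m) n_(s,m) + sum_b nfree_b n_b
   with function coefficients. *)
Record formal_vector := FormalVector {
  tcoef : 'I_N -> 'rV[R]_N -> R;
  nblk : 'I_k -> 'I_N -> 'rV[R]_N -> R;
  nfree : 'I_p -> 'rV[R]_N -> R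
}.

(* Its i-th derivative by the Leibniz rule, the derivatives of the d_j r and of
   the n's being replaced by the right-hand sides of linear_system. *)
Definition formal_derivative (i : 'I_N) (v : formal_vector) : formal_vector :=
  FormalVector
    (fun j u => partial (W := R^o) i (tcoef v j) u +
       \sum_(s < k) \sum_(m < N) nblk v s m u * weingarten m i j u)
    (fun t l u => partial (W := R^o) i (nblk v t l) u +
       \sum_(j < N) tcoef v j u * gauss_blk t l i j u)
    (fun b u => partial (W := R^o) i (nfree v b) u +
       \sum_(j < N) tcoef v j u * gauss_free b i j u).

Definition formal_tangent (l : 'I_N) : formal_vector :=
  FormalVector (fun j _ => (j == l)%:R) (fun _ _ _ => 0) (fun _ _ => 0).

Definition formal_normal_blk (s : 'I_k) (m : 'I_N) : formal_vector :=
  FormalVector (fun _ _ => 0)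
    (fun t l _ => ((t == s) && (l == m))%:R) (fun _ _ => 0).

Definition formal_normal_free (b : 'I_p) : formal_vector :=
  FormalVector (fun _ _ => 0) (fun _ _ _ => 0) (fun b' _ => (b' == b)%:R).

Definition same_coefficients (v w : formal_vector) : Prop :=
  forall u, U u ->
    [/\ forall j, tcoef v j u = tcoef w j u,
        forall t l, nblk v t l u = nblk w t l u &
        forall b, nfree v b u = nfree w b u].

Definition mixed_derivatives_agree (v : formal_vector) : Prop :=
  forall i j : 'I_N,
    same_coefficients (formal_derivative i (formal_derivative j v))
                      (formal_derivative j (formal_derivative i v)).

Definition consistency_conditions : Prop :=
  [/\ forall l, mixed_derivatives_agree (formal_tangent l),
      forall s m, mixed_derivatives_agree (formal_normal_blk s m) &
      forall b, mixed_derivatives_agree (formal_normal_free b)].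

End PotentialSubmanifolds.

(* Main.v *)
(* The coefficients of mixed second derivatives of d_l r and n_alpha differ by
   derivatives of third derivatives of Phi, which agree by Schwarz's theorem, and
   by associativity sums contracted with constant matrices.  In the conditions
   for n_((sigma-1)N+m) the contraction is by eta and by the sums over s of the
   c^(s tau), not all zero; since eta is invertible, these conditions return the
   associativity equations.

   For a framed submanifold, the d_i r and the n_alpha have invertible Gram
   matrices eta^-1 and mu^-1, so every vector is recovered from its products with
   them by contracting with eta and mu.  As the first fundamental form is constant,
   d_i d_j r has no tangential part, so the decompositions of d_i d_j r and
   d_i n_alpha involve only the second fundamental forms and the torsion, and the
   linear system says exactly that these have the prescribed values. *)

Require Import Defs.
From HB Require Import structures.
From mathcomp Require Import all_boot all_order all_algebra.
From mathcomp Require Import all_classical all_reals all_analysis.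

Set Implicit Arguments.
Unset Strict Implicit.
Unset Printing Implicit Defensive.

Import Order.TTheory GRing.Theory Num.Theory.
Import numFieldNormedType.Exports.

Local Open Scope classical_set_scope.
Local Open Scope ring_scope.

(** * Schwarz's theorem for directional derivatives *)

Lemma dist_le_halves (R : realFieldType) (x y z e : R) :
  `|x - z| < e / 2 -> `|y - z| < e / 2 -> `|x - y| <= e.
Proof.
move=> xz yz; apply: le_trans (ler_distD z x y) _.
by rewrite (splitr e) (distrC z) lerD // ltW.
Qed.

(** The two difference quotients coincide as functions of [h], so derivability and the value both
    transfer. The domains may differ: this compares a restriction to a line with a directional
    derivative, and a function with its translate. *)
Lemma is_derive_same_line {R : realType} {V1 V2 : normedModType R}
    (W : normedModType R) (f : V1 -> W) (g : V2 -> W) x v y w :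
  (forall h : R, f (h *: v + x) = g (h *: w + y)) ->
  derivable g y w -> is_derive x v f ('D_w g y).
Proof.
move=> fg dg.
have E : (fun h : R => h^-1 *: ((f \o shift x) (h *: v) - f x)) =
         (fun h : R => h^-1 *: ((g \o shift y) (h *: w) - g y)).
  apply/funext => h /=; have := fg 0; rewrite !scale0r !add0r => ->.
  by rewrite fg.
by apply: DeriveDef; rewrite /derivable /derive E.
Qed.

Section SecondDerivatives.
Context {R : realType} {V : normedModType R}.
Implicit Types (f : V -> R^o) (u v w x : V).

Lemma is_derive_line f x v (t : R) :
  derivable f (x + t *: v) v ->
  is_derive t (1 : R) (fun s : R => f (x + s *: v)) ('D_v f (x + t *: v)).
Proof.
move=> df; apply: is_derive_same_line => // h.
by rewrite scalerDl [_%:A]mulr1 addrCA.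
Qed.

Lemma mvt_line f x v (h : R) : 0 < h ->
  (forall t, t \in `[0, h]%R -> derivable f (x + t *: v) v) ->
  exists2 t, t \in `[0, h]%R & f (x + h *: v) - f x = 'D_v f (x + t *: v) * h.
Proof.
move=> h0 df.
have dl t : t \in `[0, h]%R ->
    is_derive t (1 : R) (fun s : R => f (x + s *: v)) ('D_v f (x + t *: v)).
  by move=> th; exact/is_derive_line/df.
pose g : R -> R := fun s => f (x + s *: v).
have gc : {within `[0, h], continuous g}.
  by apply: derivable_within_continuous => t th; have [] := dl t th.
have gd t : t \in `]0, h[%R -> is_derive t (1 : R) g ('D_v f (x + t *: v)).
  by move=> th; exact/dl/subset_itv_oo_cc.
have [t th E] := MVT h0 gd gc.
exists t; first exact: subset_itv_oo_cc.
by move: E; rewrite /g scale0r addr0 subr0.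
Qed.

(* The left-hand side is symmetric in v and w: this gives Schwarz's theorem. *)
Lemma mvt_square f u v w (h : R) : 0 < h ->
  (forall s t, s \in `[0, h]%R -> t \in `[0, h]%R ->
     derivable f (u + s *: v + t *: w) v /\
     derivable ('D_v f) (u + s *: v + t *: w) w) ->
  exists s t, [/\ s \in `[0, h]%R, t \in `[0, h]%R &
    f (u + h *: v + h *: w) - f (u + h *: v) - (f (u + h *: w) - f u) =
      'D_w ('D_v f) (u + s *: v + t *: w) * h * h].
Proof.
move=> h0 df.
have z0 : 0 \in `[0, h]%R by rewrite in_itv /= lexx ltW.
have hh : h \in `[0, h]%R by rewrite in_itv /= lexx ltW.
have dsh s : s \in `[0, h]%R ->
    is_derive (u + s *: v) v (fun y => f (y + h *: w) : R^o)
              ('D_v f (u + s *: v + h *: w)).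
  move=> sh; have [d _] := df s h sh hh.
  by apply: is_derive_same_line => // k; rewrite !addrA.
have dg s : s \in `[0, h]%R ->
    derivable (fun y => f (y + h *: w) - f y : R^o) (u + s *: v) v.
  move=> sh; have [d _] := df s 0 sh z0; rewrite scale0r addr0 in d.
  by apply: derivableB d; by case: (dsh s sh).
(* The mean value theorem is applied first along [v], to the increment of [f] under translation by
   [h *: w], then along [w], to the resulting derivative ['D_v f]. *)
have [s sh Es] := mvt_line h0 dg.
have [t th Et] := mvt_line h0 (fun t th => proj2 (df s t sh th)).
exists s, t; split => //.
rewrite -Et Es; congr (_ * _).
have [d _] := df s 0 sh z0; rewrite scale0r addr0 in d.
have [d' E'] := dsh s sh.
by rewrite -E' -(deriveB d' d).
Qed.

(** The second difference of [f] over a small parallelogram at [u] equals [h * h] times either mixed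
    derivative, each at some point of the parallelogram. By continuity both values are within
    [e / 2] of those at [u], which therefore differ by at most [e]. *)
Lemma derive_comm (U : set V) f v w : open U ->
  (forall x, U x -> [/\ derivable f x v, derivable f x w,
     derivable ('D_v f) x w & derivable ('D_w f) x v]) ->
  forall u, U u -> {for u, continuous ('D_w ('D_v f))} ->
    {for u, continuous ('D_v ('D_w f))} ->
  'D_w ('D_v f) u = 'D_v ('D_w f) u.
Proof.
move=> oU df u Uu /cvgrPdist_lt c1 /cvgrPdist_lt c2.
apply/eqP; rewrite -subr_eq0 -normr_le0; apply/ler_addgt0Pl => e e0; rewrite addr0.
have e2 : 0 < e / 2 by rewrite divr_gt0.
have nU : nbhs u U by apply: open_nbhs_nbhs.
have : nbhs u (U `&`
    ([set x | `|'D_w ('D_v f) u - 'D_w ('D_v f) x| < e / 2] `&`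
     [set x | `|'D_v ('D_w f) u - 'D_v ('D_w f) x| < e / 2])).
  exact: filterI nU (filterI (c1 _ e2) (c2 _ e2)).
move=> /nbhs_ballP[d /= d0]; rewrite -ball_normE => db.
(* Moves of at most [h] along [v] and [w] have total length at most [d / 2], so the parallelogram
   stays in the ball of radius [d]. The summand 1 keeps the denominator positive when both vectors
   vanish. *)
pose h := d / (1 + `|v| + `|w|) / 2.
have p0 : 0 < 1 + `|v| + `|w|.
  by rewrite -addrA ltr_pwDl // addr_ge0.
have h0 : 0 < h by rewrite !divr_gt0.
have inb s t : s \in `[0, h]%R -> t \in `[0, h]%R ->
    ball_ Num.norm u d (u + s *: v + t *: w).
  rewrite !in_itv /= => /andP[s0 sh] /andP[t0 th].
  rewrite -addrA opprD addrA subrr add0r normrN.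
  apply: le_lt_trans (ler_normD _ _) _; rewrite !normrZ !ger0_norm //.
  apply: (@le_lt_trans _ _ (h * (1 + `|v| + `|w|))).
    by rewrite -addrA mulrDr mulr1 mulrDr ler_wpDl ?(ltW h0) // lerD // ler_wpM2r.
  rewrite /h mulrAC divfK ?gt_eqF // ltr_pdivrMr // ltr_pMr //.
  by rewrite ltr1n.
have [s [t [sh th E1]]] := @mvt_square f u v w h h0 (fun s t sh th =>
  let: And4 a b c d := df _ (let: conj p _ := db _ (inb s t sh th) in p) in conj a c).
have inb' a b : a \in `[0, h]%R -> b \in `[0, h]%R ->
    ball_ Num.norm u d (u + a *: w + b *: v).
  by move=> ah bh; rewrite addrAC; exact: inb.
have [t' [s' [th' sh' E2]]] := @mvt_square f u w v h h0 (fun s t sh th =>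
  let: And4 a b c d := df _ (let: conj p _ := db _ (inb' s t sh th) in p) in conj b d).
have [_ [b1 _]] := db _ (inb s t sh th).
have [_ [_ b2]] := db _ (inb' t' s' th' sh').
(* The second difference is unchanged when the two middle vertices are exchanged, which identifies
   [E1] with [E2]. *)
have swap (x y z t0 : R) : x - y - (z - t0) = x - z - (y - t0).
  by rewrite !opprB addrACA (addrC (- y)) addrACA.
have E : 'D_w ('D_v f) (u + s *: v + t *: w) =
         'D_v ('D_w f) (u + t' *: w + s' *: v).
  have hn : h != 0 by rewrite gt_eqF.
  apply: (mulIf hn); apply: (mulIf hn).
  rewrite (addrAC u (h *: w)) in E2.
  exact: etrans (esym E1) (etrans (swap _ _ _ _) E2).
rewrite /= -E in b2.
exact: (dist_le_halves b1 b2).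
Qed.

End SecondDerivatives.

Lemma is_derive_coord {R : realType} {V : normedModType R} d (f : V -> 'rV[R]_d)
    (u e : V) b :
  derivable f u e -> is_derive u e (fun x => f x 0 b : R^o) ('D_e f u 0 b).
Proof.
move=> df; apply: DeriveDef; first exact: ((derivable_mxP _ _ _).1 df 0 b).
by rewrite (derive_mx df) mxE.
Qed.

(** * Locality of limits and derivatives on an open set *)

Section OpenSet.
Context {R : realType} {V W : normedModType R}.
Variables (U : set V) (U_open : open U).
Implicit Types (f g : V -> W) (u v : V).

(** Since [U] is open, [h *: v + u] lies in [U] for small [h]. The equality is one of filters
    because both derivability and the derivative are read off from this filter. *)
Lemma quotient_eq_on_open f g u v : U u -> (forall x, U x -> f x = g x) ->
  (fun h : R => h^-1 *: ((f \o shift u) (h *: v) - f u)) @ 0^' =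
  (fun h : R => h^-1 *: ((g \o shift u) (h *: v) - g u)) @ 0^'.
Proof.
move=> Uu fg.
have cl : {for (0 : R), continuous (fun h : R => h *: v + u)}.
  by apply: continuousD; [exact: scalel_continuous|exact: cst_continuous].
have nU : \forall h \near (0 : R)^', U (h *: v + u).
  apply: nbhs_dnbhs; apply: cl; rewrite scale0r add0r.
  exact: open_nbhs_nbhs.
apply/seteqP; split; apply: near_eq_cvg; apply: filterS nU => h Uh /=;
  by rewrite !fg.
Qed.

Lemma derive_eq_on_open f g u v : U u -> (forall x, U x -> f x = g x) ->
  'D_v f u = 'D_v g u.
Proof. by move=> Uu fg; rewrite /derive (quotient_eq_on_open v Uu fg). Qed.

Lemma derivable_eq_on_open f g u v : U u -> (forall x, U x -> f x = g x) ->
  derivable f u v -> derivable g u v.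
Proof. by move=> Uu fg; rewrite /derivable (quotient_eq_on_open v Uu fg). Qed.

Lemma continuous_eq_on_open f g u : U u -> (forall x, U x -> f x = g x) ->
  {for u, continuous f} -> {for u, continuous g}.
Proof.
move=> Uu fg; rewrite /prop_for /continuous_at fg //; apply: cvg_trans.
apply: near_eq_cvg; have : nbhs u U by exact: open_nbhs_nbhs.
by apply: filterS => x Ux; rewrite fg.
Qed.

End OpenSet.

(** * Smooth functions and their partial derivatives *)

Section Smooth.
Context {R : realType} {N : nat} {U : set 'rV[R]_N} (U_open : open U).

Section OneTarget.
Context {W : normedModType R}.
Implicit Types f g : 'rV[R]_N -> W.

Lemma smooth_partial f i : smooth U f -> smooth U (partial i f).
Proof. by move=> sf m; exact: (sf m.+1).2. Qed.

Lemma smooth_derivable f u i : smooth U f -> U u ->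
  derivable f u (delta_mx 0 i : 'rV[R]_N).
Proof. by move=> sf Uu; have [df _] := sf 1%N; exact: df. Qed.

Lemma smooth_continuous f u : smooth U f -> U u -> {for u, continuous f}.
Proof. by move=> sf Uu; exact: sf 0%N u Uu. Qed.

Lemma partial_eq_on_open f g i u : U u -> (forall x, U x -> f x = g x) ->
  partial i f u = partial i g u.
Proof. exact: derive_eq_on_open. Qed.

Lemma Ck_eq_on_open m f g : (forall x, U x -> f x = g x) ->
  Ck U m f -> Ck U m g.
Proof.
elim: m f g => [|m IH] f g fg /=.
  by move=> cf u Uu; exact: (continuous_eq_on_open U_open Uu fg (cf u Uu)).
move=> [df pf]; split=> [i u Uu|i].
  by apply: (derivable_eq_on_open U_open Uu fg); exact: df.
by apply: IH (pf i) => x Ux; exact: partial_eq_on_open.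
Qed.

End OneTarget.

Lemma partial_coord d (f : 'rV[R]_N -> 'rV[R]_d) i u b :
  derivable f u (delta_mx 0 i : 'rV[R]_N) ->
  partial i f u 0 b = partial (W := R^o) i (fun x => f x 0 b) u.
Proof. by move=> df; have [_ dE] := is_derive_coord b df; exact: esym dE. Qed.

Lemma smooth_coord d (f : 'rV[R]_N -> 'rV[R]_d) b :
  smooth U f -> smooth (W := R^o) U (fun x => f x 0 b).
Proof.
move=> sf m; elim: m f sf => [|m IH] f sf /=.
  move=> u Uu; have cu := smooth_continuous sf Uu.
  exact: (@continuous_comp _ _ _ f (fun v : 'rV[R]_d => v 0 b) u cu
    (@coord_continuous R 1 d 0 b (f u))).
split=> [i u Uu|i]; first exact: ((derivable_mxP _ _ _).1 (smooth_derivable sf Uu) 0 b).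
apply: (@Ck_eq_on_open _ _ (fun x => partial i f x 0 b)).
  by move=> x Ux; rewrite partial_coord //; exact: smooth_derivable.
exact/IH/smooth_partial.
Qed.

Lemma partial_comm (f : 'rV[R]_N -> R^o) i j u : smooth U f -> U u ->
  partial i (partial j f) u = partial j (partial i f) u.
Proof.
move=> sf Uu; apply: (derive_comm U_open) => // [x Ux||].
- by split; do ?[exact: smooth_derivable];
    apply: smooth_derivable => //; exact: smooth_partial.
- by apply: smooth_continuous => //; do 2!apply: smooth_partial.
- by apply: smooth_continuous => //; do 2!apply: smooth_partial.
Qed.

(** Schwarz's theorem above is for real-valued functions, so the vector case goes through
    coordinates. *)
Lemma partial_comm_rv d (f : 'rV[R]_N -> 'rV[R]_d) i j u : smooth U f -> U u ->
  partial i (partial j f) u = partial j (partial i f) u.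
Proof.
move=> sf Uu; apply/rowP => b.
have dE h l : partial h (partial l f) u 0 b =
    partial (W := R^o) h (partial (W := R^o) l (fun x => f x 0 b)) u.
  rewrite partial_coord; last by apply: smooth_derivable => //; exact: smooth_partial.
  apply: partial_eq_on_open => // x Ux.
  by rewrite partial_coord //; exact: smooth_derivable.
apply: etrans (dE i j) (etrans _ (esym (dE j i))).
exact: (partial_comm i j (smooth_coord b sf) Uu).
Qed.

End Smooth.

(** * Algebra of the ambient bilinear form and its product rule *)

Section BilinearForm.
Context {R : realType} {d : nat}.
Variable G : 'M[R]_d.
Implicit Types v w : 'rV[R]_d.

Lemma bformDl v w x : bform G (v + w) x = bform G v x + bform G w x.
Proof. by rewrite /bform !mulmxDl mxE. Qed.

Lemma bformZl a v w : bform G (a *: v) w = a * bform G v w.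
Proof. by rewrite /bform -!scalemxAl mxE. Qed.

Lemma bform0l w : bform G 0 w = 0.
Proof. by rewrite /bform !mul0mx mxE. Qed.

Lemma bformNl v w : bform G (- v) w = - bform G v w.
Proof. by rewrite /bform !mulNmx mxE. Qed.

Lemma bform_suml I (s : seq I) (P : pred I) (F : I -> 'rV[R]_d) w :
  bform G (\sum_(i <- s | P i) F i) w = \sum_(i <- s | P i) bform G (F i) w.
Proof. by rewrite /bform !mulmx_suml summxE. Qed.

Lemma bformC v w : G^T = G -> bform G v w = bform G w v.
Proof.
move=> Gs; rewrite /bform -[in LHS](trmxK (v *m G *m w^T)) mxE.
by rewrite !trmx_mul trmxK Gs mulmxA.
Qed.

Lemma bformE v w :
  bform G v w = \sum_(a < d) \sum_(b < d) G a b * (v 0 a * w 0 b).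
Proof.
rewrite /bform mxE exchange_big /=; apply: eq_bigr => b _.
by rewrite !mxE mulr_suml; apply: eq_bigr => a _; rewrite mulrCA mulrA.
Qed.

(** In coordinates the form is a finite constant-coefficient sum of products of scalar functions, so
    the scalar product rule applies term by term. *)
Lemma is_derive_bform (V : normedModType R) (f g : V -> 'rV[R]_d) (u e : V) :
  derivable f u e -> derivable g u e ->
  is_derive u e (fun x => bform G (f x) (g x) : R^o)
    (bform G ('D_e f u) (g u) + bform G (f u) ('D_e g u)).
Proof.
move=> df dg.
have -> : (fun x => bform G (f x) (g x) : R^o) =
  \sum_(a < d) \sum_(b < d) (G a b *: ((fun x => f x 0 a) * (fun x => g x 0 b))).
  apply/funext => x; rewrite bformE fct_sumE; apply: eq_bigr => a _.
  by rewrite fct_sumE.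
have dfa a : is_derive u e (fun x => f x 0 a : R^o) ('D_e f u 0 a).
  by apply: is_derive_coord.
have dga a : is_derive u e (fun x => g x 0 a : R^o) ('D_e g u 0 a).
  by apply: is_derive_coord.
apply: is_derive_eq; rewrite !bformE -big_split /=; apply: eq_bigr => a _.
rewrite -big_split /=; apply: eq_bigr => b _.
rewrite -mulrDr; congr (_ * _); rewrite addrC; congr (_ + _); exact: mulrC.
Qed.

End BilinearForm.

(** * Splitting sums over normal indices into blocks *)

Section BlockIndices.
Context {k N p : nat}.

Lemma blk_inj (s s' : 'I_k) (m m' : 'I_N) :
  (blk s m : 'I_(k * N + p)) = blk s' m' -> s = s' /\ m = m'.
Proof.
move=> /(congr1 val) /= E.
have N0 : (0 < N)%N by exact: leq_ltn_trans (ltn_ord m).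
split; apply: val_inj => /=.
  by move/(congr1 (divn^~ N)): E; rewrite !divnMDl // !divn_small // !addn0.
by move/(congr1 (modn^~ N)): E; rewrite !modnMDl !modn_small.
Qed.

(** The pairs [(s, m)] inject into the indices below [k * N] by uniqueness of Euclidean division,
    and both sets have [k * N] elements, so the injection is a bijection. *)
Lemma big_blk (V : nmodType) (F : 'I_(k * N + p) -> V) :
  \sum_a F a =
  \sum_(s < k) \sum_(m < N) F (blk s m) + \sum_(b < p) F (extra b).
Proof.
rewrite big_split_ord /=; congr (_ + _).
rewrite pair_big /=.
pose f (q : 'I_k * 'I_N) := Ordinal (blk_subproof q.1 q.2).
rewrite (reindex f) //; apply: onW_bij; apply: inj_card_bij.
  move=> [s m] [s' m'] E; have [] := @blk_inj s s' m m'; last by move=> -> ->.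
  by apply: val_inj; have := congr1 val E.
by rewrite card_prod !card_ord.
Qed.

End BlockIndices.

(** * Symmetries of the third and fourth derivatives of the potential *)

Section ThirdDerivatives.
Context {R : realType} {N : nat} {U : set 'rV[R]_N} (U_open : open U).
Variable Phi : 'rV[R]_N -> R.
Hypothesis Phi_smooth : smooth (W := R^o) U Phi.

Lemma smooth_partial3 i j m : smooth (W := R^o) U (partial3 Phi i j m).
Proof. by do 3!apply: smooth_partial. Qed.

Lemma partial3_swap12 i j m u : U u -> partial3 Phi i j m u = partial3 Phi j i m u.
Proof. by move=> Uu; exact: (partial_comm U_open i j (smooth_partial m Phi_smooth)). Qed.

Lemma partial3_swap23 i j m u : U u -> partial3 Phi i j m u = partial3 Phi i m j u.
Proof.
move=> Uu.
exact: (partial_eq_on_open U_open i Uu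
  (fun x Ux => partial_comm U_open j m Phi_smooth Ux)).
Qed.

Lemma partial3_rot i j m u : U u -> partial3 Phi i j m u = partial3 Phi m i j u.
Proof.
move=> Uu.
exact (etrans (partial3_swap23 i j m Uu) (partial3_swap12 i m j Uu)).
Qed.

Lemma partial_partial3_comm h i j m u : U u ->
  partial (W := R^o) h (partial3 Phi i j m) u =
  partial (W := R^o) i (partial3 Phi h j m) u.
Proof.
exact: (partial_comm U_open h i (smooth_partial j (smooth_partial m Phi_smooth))).
Qed.

Lemma partial_lincomb n (a : 'I_n -> R) (F : 'I_n -> 'rV[R]_N -> R^o) h u :
  (forall m, smooth U (F m)) -> U u ->
  partial (W := R^o) h (fun x => \sum_(m < n) a m * F m x) u =
  \sum_(m < n) a m * partial h (F m) u.
Proof.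
move=> sF Uu.
have -> : (fun x => \sum_(m < n) a m * F m x : R^o) = \sum_(m < n) a m *: F m.
  by apply/funext => x; rewrite fct_sumE.
have dF m : is_derive u (delta_mx 0 h : 'rV[R]_N) (a m *: F m) (a m *: partial h (F m) u).
  by apply: is_deriveZ; apply: derivableP; exact: smooth_derivable (sF m) Uu.
by have [_] := is_derive_sum dF.
Qed.

(** The coefficients of the linear system are constant combinations of third derivatives; this
    reduces the symmetry of their derivatives to that of fourth derivatives. *)
Lemma partial_lincomb_comm n (a : 'I_n -> R) (F G : 'I_n -> 'rV[R]_N -> R^o) h l u :
  (forall m, smooth U (F m)) -> (forall m, smooth U (G m)) -> U u ->
  (forall m, partial h (F m) u = partial l (G m) u) ->
  partial (W := R^o) h (fun x => \sum_(m < n) a m * F m x) u =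
  partial (W := R^o) l (fun x => \sum_(m < n) a m * G m x) u.
Proof.
move=> sF sG Uu FG; rewrite (partial_lincomb a h sF Uu) (partial_lincomb a l sG Uu).
by apply: eq_bigr => m _; rewrite FG.
Qed.

End ThirdDerivatives.

Lemma partial_cst {R : realType} {N : nat} (a : R) (h : 'I_N) :
  partial (W := R^o) h (fun _ => a) = fun _ => 0.
Proof. by apply/funext => u; exact: (@derive_cst R 'rV[R]_N R^o a u). Qed.

(* Keeps unification from comparing distinct derivatives by unfolding limits. *)
#[local] Opaque partial partial3.

(** * Equivalence of the consistency conditions with associativity *)

Section Consistency.
Context {R : realType} {k N p : nat} {U : set 'rV[R]_N} (U_open : open U).
Variables (Phi : 'rV[R]_N -> R) (Phi_smooth : smooth (W := R^o) U Phi).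
Variables (eta : 'M[R]_N) (c : 'M[R]_k) (mu : 'M[R]_(k * N + p)).

(** The same third derivatives occur in every block, so [c] enters the Gauss coefficients only
    through its column sums, and the mixed entries of [mu] only through their sums over the
    blocks. *)
Let C (t : 'I_k) : R := \sum_(s < k) c s t.
Let B (b : 'I_p) (n : 'I_N) : R := \sum_(s < k) mu (blk s n) (extra b).

(** As a function of four indices, this turns associativity into symmetry in the two middle ones. *)
Definition wdvv (u : 'rV[R]_N) (i j m n : 'I_N) : R :=
  \sum_(a < N) \sum_(b < N)
     partial3 Phi i j a u * eta a b * partial3 Phi b m n u.

Lemma gauss_blkE t l i j u :
  gauss_blk Phi eta c t l i j u = \sum_(n < N) (C t * eta n l) * partial3 Phi i j n u.
Proof.
rewrite /gauss_blk exchange_big /=; apply: eq_bigr => n _.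
by rewrite !mulr_suml.
Qed.

Lemma gauss_freeE b i j u :
  gauss_free Phi mu b i j u = \sum_(n < N) B b n * partial3 Phi i j n u.
Proof.
rewrite /gauss_free exchange_big /=; apply: eq_bigr => n _.
by rewrite mulr_suml.
Qed.

Lemma weingarten_partial3 (eta_sym : eta^T = eta) m i h n u : U u ->
  \sum_(j < N) weingarten Phi eta m i j u * partial3 Phi h j n u =
  - wdvv u m i h n.
Proof.
move=> Uu; rewrite /wdvv exchange_big /= -sumrN; apply: eq_bigr => j _.
rewrite /weingarten mulNr mulr_suml; apply: (congr1 -%R); apply: eq_bigr => l _.
rewrite (partial3_swap12 U_open Phi_smooth h j n Uu).
rewrite -(partial3_rot U_open Phi_smooth m i l Uu).
by rewrite -[in eta j l]eta_sym mxE [eta l j * _]mulrC.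
Qed.

(** This contraction gives the normal coefficients in the second derivatives of a block normal
    vector: [a] is [C t * eta n l] for a block direction and [B b] for an extra one. *)
Lemma weingarten_lincomb (eta_sym : eta^T = eta) (a : 'I_N -> R) m i h u : U u ->
  \sum_(j < N) weingarten Phi eta m i j u * (\sum_(n < N) a n * partial3 Phi h j n u)
  = - \sum_(n < N) a n * wdvv u m i h n.
Proof.
move=> Uu; under eq_bigr do rewrite mulr_sumr.
rewrite exchange_big /= -sumrN; apply: eq_bigr => n _.
rewrite -mulrN -weingarten_partial3 // mulr_sumr; apply: eq_bigr => j _.
by rewrite mulrCA.
Qed.

(** This is the tangential coefficient in the second derivatives of a tangent vector. The Weingarten
    coefficients do not depend on the block, so [c] contributes only the sum of all its entries. *)
Lemma gauss_blk_weingarten i j l h u : U u ->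
  \sum_(s < k) \sum_(m < N) gauss_blk Phi eta c s m j l u * weingarten Phi eta m i h u
  = - (\sum_(s < k) C s) * \sum_(a < N) eta h a * wdvv u l j i a.
Proof.
move=> Uu.
have key : \sum_(m < N) (\sum_(n < N) eta n m * partial3 Phi j l n u) *
    (\sum_(a < N) eta h a * partial3 Phi a m i u) =
    \sum_(a < N) eta h a * wdvv u l j i a.
  under eq_bigr do rewrite mulr_sumr.
  rewrite exchange_big /=; apply: eq_bigr => a _; rewrite /wdvv.
  under eq_bigr do rewrite mulr_suml.
  rewrite exchange_big /= mulr_sumr; apply: eq_bigr => n _.
  rewrite mulr_sumr; apply: eq_bigr => m _.
  rewrite (partial3_swap12 U_open Phi_smooth j l n Uu).
  rewrite (partial3_swap12 U_open Phi_smooth a m i Uu).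
  rewrite (partial3_swap23 U_open Phi_smooth m a i Uu).
  by rewrite mulrCA (mulrC (eta n m)).
rewrite mulNr mulr_suml -sumrN; apply: eq_bigr => s _.
rewrite -key -mulrN -sumrN mulr_sumr; apply: eq_bigr => m _.
rewrite gauss_blkE /weingarten !mulrN mulrA; congr (- (_ * _)).
by rewrite mulr_sumr; apply: eq_bigr => n _; rewrite mulrA.
Qed.

Lemma partial_gauss_blk_comm i j l t n u : U u ->
  partial (W := R^o) i (gauss_blk Phi eta c t n j l) u =
  partial (W := R^o) j (gauss_blk Phi eta c t n i l) u.
Proof.
move=> Uu.
have E h : gauss_blk Phi eta c t n h l =
    (fun x => \sum_(m < N) (C t * eta m n) * partial3 Phi h l m x).
  by apply/funext => x; exact: gauss_blkE.
rewrite !E; apply: (partial_lincomb_comm _ _ _ Uu) => m.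
- exact: smooth_partial3.
- exact: smooth_partial3.
- exact (partial_partial3_comm U_open Phi_smooth i j l m Uu).
Qed.

Lemma partial_gauss_free_comm i j l b u : U u ->
  partial (W := R^o) i (gauss_free Phi mu b j l) u =
  partial (W := R^o) j (gauss_free Phi mu b i l) u.
Proof.
move=> Uu.
have E h : gauss_free Phi mu b h l =
    (fun x => \sum_(m < N) B b m * partial3 Phi h l m x).
  by apply/funext => x; exact: gauss_freeE.
rewrite !E; apply: (partial_lincomb_comm _ _ _ Uu) => m.
- exact: smooth_partial3.
- exact: smooth_partial3.
- exact (partial_partial3_comm U_open Phi_smooth i j l m Uu).
Qed.

Lemma partial_weingarten_comm m h i j u : U u ->
  partial (W := R^o) i (weingarten Phi eta m j h) u =
  partial (W := R^o) j (weingarten Phi eta m i h) u.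
Proof.
move=> Uu.
have sP a g : smooth (W := R^o) U (partial3 Phi g a m) by exact: smooth_partial3.
(* This form uses the symmetry of third derivatives, which holds on [U]; hence an equality on [U],
   carried under the derivative by openness, instead of an equality of functions. *)
have E g x : U x -> weingarten Phi eta m g h x =
    \sum_(a < N) (- eta h a) * partial3 Phi g a m x.
  move=> Ux; rewrite /weingarten -sumrN; apply: eq_bigr => a _.
  by rewrite mulNr -(partial3_rot U_open Phi_smooth a m g Ux).
apply: etrans (partial_eq_on_open U_open i Uu (E j)) _.
apply: etrans _ (esym (partial_eq_on_open U_open j Uu (E i))).
exact (partial_lincomb_comm _ (sP ^~ j) (sP ^~ i) Uu
  (fun a => partial_partial3_comm U_open Phi_smooth i j a m Uu)).
Qed.

Lemma associativity_wdvv : associativity U eta Phi <->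
  forall u, U u -> forall i j m n, wdvv u i j m n = wdvv u i m j n.
Proof. by []. Qed.

#[local] Opaque gauss_blk gauss_free weingarten wdvv.

(** A frame vector has constant coefficients, so its first formal derivative is just the
    corresponding right-hand side of the system: purely normal here, purely tangential for a block
    normal vector, zero for an extra one. *)
Lemma derivative_formal_tangent j l :
  formal_derivative Phi eta c mu j (formal_tangent l) =
  FormalVector (fun _ _ => 0) (fun t n => gauss_blk Phi eta c t n j l)
    (fun b => gauss_free Phi mu b j l).
Proof.
rewrite /formal_derivative /formal_tangent /=.
have pick (F : 'I_N -> R) : \sum_(h < N) (h == l)%:R * F h = F l.
  by rewrite (bigD1 l) //= eqxx mul1r big1 ?addr0 // => h /negPf ->; rewrite mul0r.
congr FormalVector; apply/funext => a.
- apply/funext => u; rewrite partial_cst add0r big1 // => s _.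
  by rewrite big1 // => m _; rewrite mul0r.
- by apply/funext => n; apply/funext => u; rewrite partial_cst add0r pick.
- by apply/funext => u; rewrite partial_cst add0r pick.
Qed.

Lemma derivative_formal_normal_blk i s m :
  formal_derivative Phi eta c mu i (formal_normal_blk s m) =
  FormalVector (fun j => weingarten Phi eta m i j) (fun _ _ _ => 0) (fun _ _ => 0).
Proof.
rewrite /formal_derivative /formal_normal_blk /=.
congr FormalVector; apply/funext => a.
- apply/funext => u; rewrite partial_cst add0r (bigD1 s) //= (bigD1 m) //= !eqxx mul1r.
  rewrite big1 ?addr0 => [|n /negPf ->]; last by rewrite mul0r.
  rewrite big1 ?addr0 // => t /negPf ->; rewrite big1 // => n _.
  by rewrite mul0r.
- apply/funext => n; apply/funext => u; rewrite partial_cst add0r big1 // => h _.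
  by rewrite mul0r.
- by apply/funext => u; rewrite partial_cst add0r big1 // => h _; rewrite mul0r.
Qed.

Lemma derivative_formal_normal_free i b :
  formal_derivative Phi eta c mu i (formal_normal_free b) =
  FormalVector (fun _ _ => 0) (fun _ _ _ => 0) (fun _ _ => 0).
Proof.
rewrite /formal_derivative /formal_normal_free /=.
congr FormalVector; apply/funext => a.
- apply/funext => u; rewrite partial_cst add0r big1 // => s _.
  by rewrite big1 // => m _; rewrite mul0r.
- apply/funext => n; apply/funext => u; rewrite partial_cst add0r big1 // => h _.
  by rewrite mul0r.
- by apply/funext => u; rewrite partial_cst add0r big1 // => h _; rewrite mul0r.
Qed.

Let sum_mul0 n (F : 'I_n -> R) : \sum_h 0 * F h = 0.
Proof. by apply: big1 => h _; rewrite mul0r. Qed.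

Let sum2_mul0 n n' (F : 'I_n -> 'I_n' -> R) : \sum_h \sum_l 0 * F h l = 0.
Proof. by apply: big1 => h _; rewrite sum_mul0. Qed.

Lemma tcoef_derivative_normal i nb nf h u :
  tcoef (formal_derivative Phi eta c mu i
    (FormalVector (fun _ _ => 0) nb nf)) h u =
  \sum_(s < k) \sum_(m < N) nb s m u * weingarten Phi eta m i h u.
Proof. by rewrite /= partial_cst; exact: add0r. Qed.

Lemma nblk_derivative_normal i nb nf t n u :
  nblk (formal_derivative Phi eta c mu i
    (FormalVector (fun _ _ => 0) nb nf)) t n u =
  partial (W := R^o) i (nb t n) u.
Proof. by rewrite /= sum_mul0; exact: addr0. Qed.

Lemma nfree_derivative_normal i nb nf b u :
  nfree (formal_derivative Phi eta c mu i
    (FormalVector (fun _ _ => 0) nb nf)) b u =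
  partial (W := R^o) i (nf b) u.
Proof. by rewrite /= sum_mul0; exact: addr0. Qed.

Lemma tcoef_derivative_tangent i tc h u :
  tcoef (formal_derivative Phi eta c mu i
    (FormalVector tc (fun _ _ _ => 0) (fun _ _ => 0))) h u =
  partial (W := R^o) i (tc h) u.
Proof. by rewrite /= sum2_mul0; exact: addr0. Qed.

Lemma nblk_derivative_tangent i tc t l u :
  nblk (formal_derivative Phi eta c mu i
    (FormalVector tc (fun _ _ _ => 0) (fun _ _ => 0))) t l u =
  \sum_(j < N) tc j u * (\sum_(n < N) (C t * eta n l) * partial3 Phi i j n u).
Proof.
rewrite /= partial_cst; apply: etrans (add0r _) _.
by apply: eq_bigr => j _; rewrite gauss_blkE.
Qed.

Lemma nfree_derivative_tangent i tc b u :
  nfree (formal_derivative Phi eta c mu i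
    (FormalVector tc (fun _ _ _ => 0) (fun _ _ => 0))) b u =
  \sum_(j < N) tc j u * (\sum_(n < N) B b n * partial3 Phi i j n u).
Proof.
rewrite /= partial_cst; apply: etrans (add0r _) _.
by apply: eq_bigr => j _; rewrite gauss_freeE.
Qed.

(** For tangent vectors the tangential comparison is contracted associativity and the normal ones
    are Schwarz's theorem; for block normal vectors the roles are exchanged; for extra normal
    vectors both sides vanish. *)
Lemma associativity_consistency : eta^T = eta ->
  associativity U eta Phi -> consistency_conditions U Phi eta c mu.
Proof.
move=> eta_sym /associativity_wdvv wE.
split=> [l|s m|b] i j u Uu.
- rewrite !derivative_formal_tangent; split=> [h|t n|b].
  + apply: etrans (tcoef_derivative_normal i _ _ h u) _.
    apply: etrans _ (esym (tcoef_derivative_normal j _ _ h u)).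
    apply: etrans (gauss_blk_weingarten i j l h Uu) _.
    apply: etrans _ (esym (gauss_blk_weingarten j i l h Uu)).
    apply: (congr1 (fun x => - (\sum_(s < k) C s) * x)).
    by apply: eq_bigr => a _; rewrite (wE u Uu l j i a).
  + apply: etrans (nblk_derivative_normal i _ _ t n u) _.
    apply: etrans _ (esym (nblk_derivative_normal j _ _ t n u)).
    exact (partial_gauss_blk_comm i j l t n Uu).
  + apply: etrans (nfree_derivative_normal i _ _ b u) _.
    apply: etrans _ (esym (nfree_derivative_normal j _ _ b u)).
    exact (partial_gauss_free_comm i j l b Uu).
- have sym (a : 'I_N -> R) :
      \sum_(h < N) weingarten Phi eta m j h u *
        (\sum_(n < N) a n * partial3 Phi i h n u) =
      \sum_(h < N) weingarten Phi eta m i h u *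
        (\sum_(n < N) a n * partial3 Phi j h n u).
    apply: etrans (weingarten_lincomb eta_sym a m j i Uu) _.
    apply: etrans _ (esym (weingarten_lincomb eta_sym a m i j Uu)).
    by apply: (congr1 -%R); apply: eq_bigr => n _; rewrite (wE u Uu m j i n).
  rewrite !derivative_formal_normal_blk; split=> [h|t n|b].
  + apply: etrans (tcoef_derivative_tangent i _ h u) _.
    apply: etrans _ (esym (tcoef_derivative_tangent j _ h u)).
    exact (partial_weingarten_comm m h i j Uu).
  + apply: etrans (nblk_derivative_tangent i _ t n u) _.
    apply: etrans _ (esym (nblk_derivative_tangent j _ t n u)).
    exact (sym (fun n' => C t * eta n' n)).
  + apply: etrans (nfree_derivative_tangent i _ b u) _.
    apply: etrans _ (esym (nfree_derivative_tangent j _ b u)).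
    exact (sym (B b)).
- rewrite !derivative_formal_normal_free; split=> [h|t n|b'].
  + apply: etrans (tcoef_derivative_normal i _ _ h u) _.
    apply: etrans _ (esym (tcoef_derivative_normal j _ _ h u)).
    exact (etrans (sum2_mul0 _) (esym (sum2_mul0 _))).
  + apply: etrans (nblk_derivative_normal i _ _ t n u) _.
    apply: etrans _ (esym (nblk_derivative_normal j _ _ t n u)).
    exact (congr1 (@^~ u) (etrans (partial_cst 0 i) (esym (partial_cst 0 j)))).
  + apply: etrans (nfree_derivative_normal i _ _ b' u) _.
    apply: etrans _ (esym (nfree_derivative_normal j _ _ b' u)).
    exact (congr1 (@^~ u) (etrans (partial_cst 0 i) (esym (partial_cst 0 j)))).
Qed.

Lemma consistency_associativity : eta^T = eta -> eta \in unitmx ->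
  c \in unitmx -> (0 < k)%N ->
  consistency_conditions U Phi eta c mu -> associativity U eta Phi.
Proof.
move=> eta_sym eta_u c_u k0 [_ cons _].
apply/associativity_wdvv => u Uu m i j n.
(* The rows of c are independent, so their sum does not vanish; the total sum
   of the entries of c may vanish, which is why the conditions on the tangent
   vectors alone would not give associativity. *)
have [t Ct] : exists t, C t != 0.
  apply/existsP; rewrite -[[exists _, _]]negbK negb_exists; apply/negP => /forallP C0.
  have : (const_mx 1 : 'rV[R]_k) *m c = 0.
    apply/rowP => t; rewrite !mxE; have /negPn/eqP := C0 t; apply: etrans.
    by apply: eq_bigr => s _; rewrite mxE mul1r.
  move=> /(congr1 (mulmx^~ (invmx c))); rewrite mulmxK // mul0mx.
  move=> /rowP /(_ (Ordinal k0)); rewrite !mxE => /eqP.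
  by rewrite oner_eq0.
(* The row of associativity defects as the last index varies. The block normal coefficients of the
   conditions for a normal vector of the first block say that [C t] times [x *m eta] vanishes. *)
pose x : 'rV[R]_N := \row_n (wdvv u m i j n - wdvv u m j i n).
suff x0 : x = 0.
  apply/eqP; rewrite -subr_eq0; apply/eqP.
  by move/rowP: x0 => /(_ n); rewrite !mxE.
have xe : x *m eta = 0.
  apply/rowP => l; rewrite !mxE.
  have [_ /(_ t l) + _] := cons (Ordinal k0) m j i u Uu.
  rewrite !derivative_formal_normal_blk => E0.
  have := etrans (esym (nblk_derivative_tangent j _ t l u))
    (etrans E0 (nblk_derivative_tangent i _ t l u)).
  move=> E1; have /oppr_inj E := etrans (esym (weingarten_lincomb eta_sym _ m i j Uu))
    (etrans E1 (weingarten_lincomb eta_sym _ m j i Uu)).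
  apply: (mulfI Ct); rewrite mulr0 mulr_sumr.
  have /eqP := E; rewrite -subr_eq0 -sumrB => /eqP; apply: etrans.
  by apply: eq_bigr => a _; rewrite -mulrBr mxE mulrA mulrAC.
by rewrite -[x](mulmxK eta_u) xe mul0mx.
Qed.

End Consistency.

(** An invertible congruence to a diagonal matrix transports symmetry back; this provides the
    symmetry of the ambient form. *)
Lemma signature_sym (R : realType) d (G : 'M[R]_d) s t :
  has_signature G s t -> G^T = G.
Proof.
move=> [_ [P Pu E]].
have : P *m G^T *m P^T = P *m G *m P^T.
  have -> : P *m G^T *m P^T = (P *m G *m P^T)^T by rewrite !trmx_mul trmxK mulmxA.
  by rewrite E tr_diag_mx.
move=> /(congr1 (mulmx (invmx P))); rewrite -!mulmxA !mulKmx //.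
move=> /(congr1 (mulmx^~ (invmx P^T))).
by rewrite !mulmxK // unitmx_tr.
Qed.

Lemma invmx_sym (R : realType) d (A : 'M[R]_d) : A^T = A -> (invmx A)^T = invmx A.
Proof. by move=> As; rewrite trmx_inv As. Qed.

(** * Recovering a vector from its products with a frame *)

Section MovingFrame.
Context {R : realType} {N L d : nat}.
Variables (G : 'M[R]_d) (G_sym : G^T = G).
Variables (eta : 'M[R]_N) (eta_sym : eta^T = eta) (eta_nondeg : eta \in unitmx).
Variables (mu : 'M[R]_L) (mu_sym : mu^T = mu) (mu_nondeg : mu \in unitmx).
Variables (tg : 'I_N -> 'rV[R]_d) (nu : 'I_L -> 'rV[R]_d).
Hypothesis tangent_gram : forall i j, bform G (tg i) (tg j) = invmx eta i j.
Hypothesis normal_gram : forall a b, bform G (nu a) (nu b) = invmx mu a b.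
Hypothesis normal_span : forall v : 'rV[R]_d,
  (v <= \matrix_(a < L) nu a)%MS <-> forall i, bform G v (tg i) = 0.

Lemma normal_tangent a i : bform G (nu a) (tg i) = 0.
Proof.
apply: (normal_span (nu a)).1.
by have := row_sub a (\matrix_(b < L) nu b); rewrite rowK.
Qed.

(* v minus its tangential part is orthogonal to every tg i, hence in the span of
   the nu a; no count of dimensions is needed. *)
Lemma frame_decomposition v :
  v = \sum_i (\sum_j eta i j * bform G v (tg j)) *: tg i +
      \sum_a (\sum_b mu a b * bform G v (nu b)) *: nu a.
Proof.
set T := \sum_i _; apply/eqP; rewrite addrC -subr_eq; apply/eqP.
have : (v - T <= \matrix_(a < L) nu a)%MS.
  apply/normal_span => i; rewrite bformDl bformNl bform_suml.
  apply/eqP; rewrite subr_eq0; apply/eqP.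
  pose y : 'cV[R]_N := \col_j bform G v (tg j).
  have -> : bform G v (tg i) = (invmx eta *m (eta *m y)) i 0.
    by rewrite mulKmx // mxE.
  rewrite mxE; apply: eq_bigr => h _; rewrite bformZl tangent_gram mulrC.
  rewrite -[in LHS](invmx_sym eta_sym) !mxE; congr (_ * _).
  by apply: eq_bigr => j _; rewrite mxE.
move=> /submxP[D DE].
have vE : v - T = \sum_a D 0 a *: nu a.
  by rewrite DE mulmx_sum_row; apply: eq_bigr => a _; rewrite rowK.
(* The tangential part [T] is orthogonal to the normals, so the products of [v] with them determine
   [D] through the inverse of their Gram matrix. *)
have Dmu b : bform G v (nu b) = (D *m invmx mu) 0 b.
  have -> : bform G v (nu b) = bform G (v - T) (nu b).
    rewrite bformDl bformNl bform_suml big1 ?oppr0 ?addr0 // => i _.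
    by rewrite bformZl (bformC _ _ G_sym) normal_tangent mulr0.
  rewrite vE bform_suml mxE; apply: eq_bigr => a _.
  by rewrite bformZl normal_gram.
rewrite vE; apply: eq_bigr => a _; congr (_ *: _).
rewrite -[D](mulmxKV mu_nondeg) mxE; apply: eq_bigr => b _.
by rewrite -Dmu mulrC -[in LHS]mu_sym mxE.
Qed.

End MovingFrame.

(* Koszul's argument: alternating the two relations gives S = - S. *)
Lemma metric_connection_free (R : numDomainType) (I : Type) (S : I -> I -> I -> R) :
  (forall i j k, S i j k = S j i k) -> (forall i j k, S i j k + S i k j = 0) ->
  forall i j k, S i j k = 0.
Proof.
move=> sym skew i j k.
have skewE a b c : S a b c = - S a c b by apply/eqP; rewrite -addr_eq0 skew.
have E : S i j k = - S i j k.
  by rewrite {1}skewE sym skewE sym skewE opprK sym.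
by apply/eqP; rewrite -[_ == 0](mulrn_eq0 _ 2) mulr2n {1}E addNr.
Qed.

(** * Gauss and Weingarten formulas for a framed submanifold *)

Section FramedSubmanifold.
Context {R : realType} {N L d : nat} {U : set 'rV[R]_N} (U_open : open U).
Variables (G : 'M[R]_d) (G_sym : G^T = G).
Variables (eta : 'M[R]_N) (mu : 'M[R]_L).
Variables (r : 'rV[R]_N -> 'rV[R]_d) (nu : 'I_L -> 'rV[R]_N -> 'rV[R]_d).
Hypothesis framed : framed_submanifold U G r nu eta mu.

Lemma framed_normal_tangent u a j : U u -> bform G (nu a u) (partial j r u) = 0.
Proof.
move=> Uu; have [_ span] := framed_normal_basis framed Uu.
exact: normal_tangent span a j.
Qed.

Lemma partial_bform (f g : 'rV[R]_N -> 'rV[R]_d) (a : R) i u :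
  smooth U f -> smooth U g -> U u ->
  (forall x, U x -> bform G (f x) (g x) = a) ->
  bform G (partial i f u) (g u) + bform G (f u) (partial i g u) = 0.
Proof.
move=> sf sg Uu fg.
have [_ E] := is_derive_bform G (smooth_derivable (i := i) sf Uu)
  (smooth_derivable (i := i) sg Uu).
apply: etrans (esym E) _.
have H := @partial_eq_on_open R N U U_open R^o
  (fun x => bform G (f x) (g x)) (fun _ => a) i u Uu fg.
apply: etrans H _; exact (congr1 (@^~ u) (partial_cst a i)).
Qed.

(** These are the Christoffel symbols of the first kind of a constant metric: symmetric in the first
    two indices by Schwarz's theorem, skew in the last two by differentiating the first fundamental
    form. *)
Lemma hessian_tangent u i j h : U u ->
  bform G (partial i (partial j r) u) (partial h r u) = 0.
Proof.
move=> Uu; have sr := framed_pos_smooth framed.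
pose S a b e := bform G (partial a (partial b r) u) (partial e r u).
apply: (@metric_connection_free R _ S) => [a b e|a b e].
  exact (congr1 (fun v => bform G v (partial e r u)) (partial_comm_rv U_open a b sr Uu)).
have := partial_bform a (smooth_partial b sr) (smooth_partial e sr) Uu
  (fun x Ux => framed_first_form framed Ux b e).
by rewrite (bformC (partial b r u) _ G_sym).
Qed.

(** Obtained by differentiating the orthogonality of [nu a] and [partial j r]. *)
Lemma normal_derivative_tangent u i a j : U u ->
  bform G (partial i (nu a) u) (partial j r u) = - second_form G r nu u a i j.
Proof.
move=> Uu; have sr := framed_pos_smooth framed.
have := partial_bform i (framed_normal_smooth framed a) (smooth_partial j sr) Uu
  (fun x Ux => framed_normal_tangent a j Ux).
rewrite (bformC (nu a u) _ G_sym) => /eqP; rewrite addr_eq0 => /eqP.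
exact.
Qed.

Hypotheses (eta_sym : eta^T = eta) (eta_nondeg : eta \in unitmx).
Hypotheses (mu_sym : mu^T = mu) (mu_nondeg : mu \in unitmx).

Lemma framed_decomposition u v : U u ->
  v = \sum_i (\sum_j eta i j * bform G v (partial j r u)) *: partial i r u +
      \sum_a (\sum_b mu a b * bform G v (nu b u)) *: nu a u.
Proof.
move=> Uu; have [_ span] := framed_normal_basis framed Uu.
apply: (frame_decomposition G_sym eta_sym eta_nondeg mu_sym mu_nondeg _ _ span).
- exact: framed_first_form framed u Uu.
- exact: framed_gram framed u Uu.
Qed.

Lemma gauss_formula u i j : U u ->
  partial i (partial j r) u =
  \sum_a (\sum_b mu a b * second_form G r nu u b i j) *: nu a u.
Proof.
move=> Uu; apply: etrans (framed_decomposition _ Uu) _.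
rewrite big1 => [|h _]; first exact: add0r.
rewrite big1 => [|l _]; first exact: scale0r.
by rewrite hessian_tangent // mulr0.
Qed.

Lemma weingarten_formula u i a : U u ->
  (forall b, torsion G nu u i a b = 0) ->
  partial i (nu a) u =
  \sum_j (- \sum_l eta j l * second_form G r nu u a i l) *: partial j r u.
Proof.
move=> Uu tors; apply: etrans (framed_decomposition _ Uu) _.
rewrite [X in _ + X]big1 => [|b _]; last first.
  rewrite big1 => [|e _]; first exact: scale0r.
  by rewrite [bform _ _ _]tors mulr0.
rewrite addr0; apply: eq_bigr => j _; congr (_ *: _).
rewrite -sumrN; apply: eq_bigr => l _.
by rewrite normal_derivative_tangent // mulrN.
Qed.

End FramedSubmanifold.

(** * The linear system as a characterization of k-potential submanifolds *)

Section PotentialSubmanifold.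
Context {R : realType} {k N p d : nat}.
Variables (eta : 'M[R]_N) (c : 'M[R]_k) (mu : 'M[R]_(k * N + p)).
Hypotheses (eta_sym : eta^T = eta) (eta_nondeg : eta \in unitmx).
Hypotheses (mu_sym : mu^T = mu) (mu_nondeg : mu \in unitmx).
Hypothesis mu_blk : forall (s t : 'I_k) (m n : 'I_N),
  mu (blk s m) (blk t n) = c s t * eta m n.
Variables (U : set 'rV[R]_N) (U_open : open U).
Variables (Phi : 'rV[R]_N -> R) (Phi_smooth : smooth (W := R^o) U Phi).
Variables (G : 'M[R]_d) (G_sym : G^T = G).
Variables (r : 'rV[R]_N -> 'rV[R]_d) (nu : 'I_(k * N + p) -> 'rV[R]_N -> 'rV[R]_d).
Hypothesis framed : framed_submanifold U G r nu eta mu.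

(** Treats both families of Gauss coefficients uniformly: by [mu_blk], its values at block and extra
    indices are [gauss_blk] and [gauss_free]. *)
Definition gauss_coef (a : 'I_(k * N + p)) (i j : 'I_N) (u : 'rV[R]_N) : R :=
  \sum_(s < k) \sum_(m < N) mu (blk s m) a * partial3 Phi i j m u.

Lemma gauss_coefE i j u :
  \sum_a gauss_coef a i j u *: nu a u =
  \sum_(t < k) \sum_(l < N) gauss_blk Phi eta c t l i j u *: nu (blk t l) u +
  \sum_(b < p) gauss_free Phi mu b i j u *: nu (extra b) u.
Proof.
rewrite big_blk; apply: (congr1 (+%R^~ _)); apply: eq_bigr => t _; apply: eq_bigr => l _.
congr (_ *: _); rewrite /gauss_coef; apply: eq_bigr => s _; apply: eq_bigr => m _.
by rewrite mu_blk.
Qed.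

Lemma gauss_coef_second_form u i j a : U u ->
  (forall s m, second_form G r nu u (blk s m) i j = partial3 Phi m i j u) ->
  (forall b, second_form G r nu u (extra b) i j = 0) ->
  \sum_b mu a b * second_form G r nu u b i j = gauss_coef a i j u.
Proof.
move=> Uu Sb Sf; rewrite big_blk [X in _ + X]big1 => [|b _]; last first.
  by rewrite Sf mulr0.
rewrite addr0; apply: eq_bigr => s _; apply: eq_bigr => m _.
rewrite Sb -[in LHS]mu_sym mxE; apply: (congr1 (fun x => _ * x)).
exact (esym (partial3_rot U_open Phi_smooth i j m Uu)).
Qed.

(** Pairing the Gauss decomposition with [nu a] multiplies [mu] by the Gram matrix [invmx mu], which
    leaves a Kronecker delta in the normal index. *)
Lemma second_form_of_gauss u i j a : U u ->
  partial i (partial j r) u = \sum_b gauss_coef b i j u *: nu b u ->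
  second_form G r nu u a i j =
  \sum_(s < k) \sum_(m < N) (blk s m == a)%:R * partial3 Phi i j m u.
Proof.
move=> Uu E; rewrite /second_form E bform_suml.
under eq_bigr => b _ do
  rewrite bformZl (framed_gram framed Uu) /gauss_coef mulr_suml.
rewrite exchange_big /=; apply: eq_bigr => s _.
under eq_bigr => b _ do rewrite mulr_suml.
rewrite exchange_big /=; apply: eq_bigr => m _.
under eq_bigr => b _ do rewrite mulrAC.
rewrite -mulr_suml; apply: (congr1 (fun x => x * _)).
have := congr1 (fun (M : 'M[R]_(k * N + p)) => M (blk s m) a) (mulmxV mu_nondeg).
by rewrite !mxE.
Qed.

Lemma linear_system_of_k_potential :
  k_potential_submanifold U Phi eta mu G r nu -> linear_system U Phi eta c mu r nu.
Proof.
move=> [_ tors Sb Sf]; split=> [u Uu i j|u Uu s m i|u Uu b i].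
- rewrite -gauss_coefE.
  apply: etrans (gauss_formula U_open G_sym framed eta_sym eta_nondeg mu_sym
    mu_nondeg i j Uu) _.
  apply: eq_bigr => a _; apply: (congr1 ( *:%R^~ _)).
  apply: gauss_coef_second_form => // [s m|b]; [exact: Sb|exact: Sf].
- apply: etrans (weingarten_formula U_open G_sym framed eta_sym eta_nondeg mu_sym
    mu_nondeg Uu (tors u Uu i (blk s m))) _.
  apply: eq_bigr => j _; apply: (congr1 ( *:%R^~ _)); rewrite /weingarten.
  apply: (congr1 -%R); apply: eq_bigr => l _; apply: (congr1 (fun x => _ * x)).
  rewrite (Sb u Uu).
  exact (partial3_rot U_open Phi_smooth m i l Uu).
- apply: etrans (weingarten_formula U_open G_sym framed eta_sym eta_nondeg mu_sym
    mu_nondeg Uu (tors u Uu i (extra b))) _.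
  apply: big1 => j _; rewrite big1 ?oppr0 ?scale0r // => l _.
  by rewrite (Sf u Uu) mulr0.
Qed.

Lemma k_potential_of_linear_system :
  linear_system U Phi eta c mu r nu -> k_potential_submanifold U Phi eta mu G r nu.
Proof.
move=> [Sg Swb Swf].
have gauss u (Uu : U u) i j :
    partial i (partial j r) u = \sum_b gauss_coef b i j u *: nu b u.
  exact: etrans (Sg u Uu i j) (esym (gauss_coefE i j u)).
split=> // [u Uu i a b|u Uu s m i j|u Uu b i j].
- rewrite /torsion -[a]splitK; case: (fintype.split a) => [a'|a'] /=; last first.
    by rewrite [partial _ _ _](Swf u Uu) bform0l.
  (* The tangent index [i] witnesses that [N] is positive, so division by [N] writes a normal index
     below [k * N] as a block index. The derivative of that normal is tangential, hence has no
     torsion. *)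
  have N0 : (0 < N)%N.
    by case: N i => [[]|].
  have sk : (a' %/ N < k)%N by rewrite ltn_divLR.
  have mN : (a' %% N < N)%N by rewrite ltn_mod.
  have -> : lshift p a' = blk (Ordinal sk) (Ordinal mN).
    by apply: val_inj; rewrite /= -divn_eq.
  rewrite (Swb u Uu) bform_suml big1 // => j _.
  by rewrite bformZl (bformC _ _ G_sym) (framed_normal_tangent framed) // mulr0.
- rewrite (second_form_of_gauss _ Uu (gauss u Uu i j)).
  (* By injectivity of [blk], only the term of index [(s, m)] survives the Kronecker delta. *)
  rewrite (bigD1 s) //= (bigD1 m) //= eqxx mul1r.
  rewrite big1 => [|n nm]; last first.
    case: eqP => [/blk_inj[_ E]|_]; last by rewrite mul0r.
    by rewrite E eqxx in nm.
  rewrite big1 => [|t ts]; last first.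
    apply: big1 => n _; case: eqP => [/blk_inj[E _]|_]; last by rewrite mul0r.
    by rewrite E eqxx in ts.
  by rewrite !addr0; exact: (partial3_rot U_open Phi_smooth i j m Uu).
- rewrite (second_form_of_gauss _ Uu (gauss u Uu i j)).
  apply: big1 => s _; apply: big1 => m _.
  by rewrite eq_lrshift mul0r.
Qed.

(** Each block of second fundamental forms is the array of third derivatives of [Phi], so raising an
    index with [eta] gives the structure functions of [mul], up to a permutation of the
    derivatives. *)
Lemma k_potential_realizes mul : frobenius_potential U eta Phi mul ->
  k_potential_submanifold U Phi eta mu G r nu -> realizes_frobenius U eta mul G r nu.
Proof.
move=> pot [_ _ Sb _] u Uu s m j; rewrite (pot u Uu).
apply: eq_bigr => l _; apply: (congr1 ( *:%R^~ _)); apply: eq_bigr => i _.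
rewrite (Sb u Uu); apply: (congr1 (fun x => _ * x)).
exact (partial3_swap12 U_open Phi_smooth i m j Uu).
Qed.

End PotentialSubmanifold.

Theorem theorem5p5 (R : realType) (k N p : nat) (hk : (1 <= k)%N)
    (eta : 'M[R]_N) (c : 'M[R]_k) (mu : 'M[R]_(k * N + p))
    (eta_sym : eta^T = eta) (eta_nondeg : eta \in unitmx)
    (c_sym : c^T = c) (c_nondeg : c \in unitmx)
    (mu_sym : mu^T = mu) (mu_nondeg : mu \in unitmx)
    (mu_blk : forall (s t : 'I_k) (m n : 'I_N),
       mu (blk s m) (blk t n) = c s t * eta m n)
    (U : set 'rV[R]_N) (U_open : open U)
    (Phi : 'rV[R]_N -> R) (Phi_smooth : smooth (W := R^o) U Phi) :
  (forall (mul : 'rV[R]_N -> 'rV[R]_N -> 'rV[R]_N -> 'rV[R]_N)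
      (G : 'M[R]_(k.+1 * N + p)) (s1 t1 s2 t2 : nat),
    associativity U eta Phi ->
    frobenius_chart U (invmx eta) mul ->
    frobenius_potential U eta Phi mul ->
    has_signature (invmx eta) s1 t1 ->
    has_signature (invmx mu) s2 t2 ->
    has_signature G (s1 + s2) (t1 + t2) ->
    consistency_conditions U Phi eta c mu /\
    forall (r : 'rV[R]_N -> 'rV[R]_(k.+1 * N + p))
      (nu : 'I_(k * N + p) -> 'rV[R]_N -> 'rV[R]_(k.+1 * N + p)),
      (k_potential_submanifold U Phi eta mu G r nu /\
       realizes_frobenius U eta mul G r nu) <->
      (framed_submanifold U G r nu eta mu /\
       linear_system U Phi eta c mu r nu)) /\
  (consistency_conditions U Phi eta c mu <-> associativity U eta Phi).
Proof.
have assoc : consistency_conditions U Phi eta c mu <-> associativity U eta Phi.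
  split; first exact: (consistency_associativity U_open Phi_smooth).
  exact: (associativity_consistency U_open Phi_smooth).
split; last exact assoc.
move=> mul G s1 t1 s2 t2 as_ _ pot _ _ /signature_sym G_sym.
split; first exact (assoc.2 as_).
move=> r nu.
split=> [[pot_sub _]|[framed sys]].
  have framed := kpot_framed pot_sub.
  split; first exact framed.
  exact (linear_system_of_k_potential eta_sym eta_nondeg mu_sym mu_nondeg mu_blk
    U_open Phi_smooth G_sym framed pot_sub).
(* The realization of the multiplication is then deduced from the second fundamental forms recovered
   here. *)
have pot_sub := k_potential_of_linear_system mu_nondeg mu_blk U_open Phi_smooth
  G_sym framed sys.
split; first exact pot_sub.
exact (k_potential_realizes U_open Phi_smooth pot pot_sub).
Qed.
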